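(* Let $\epsilon\in\mathbb{R}\setminus\{0\}$, $c_1=\frac{1}{12\epsilon}$, $c_2=\frac{1}{192\epsilon^2}$, $c_3=\frac{1}{96\epsilon^2}$. Let $N\ge 1$, let $\lambda_j=\xi_j+i\eta_j$ ($1\le j\le N$) be pairwise distinct complex numbers with $\xi_j,\eta_j\in\mathbb{R}$, $\xi_j\neq 0$, $\eta_j>0$, and let $\alpha_j,\beta_j,\gamma_j\in\mathbb{C}$ ($1\le j\le N$). For $(x,t)\in\mathbb{R}^2$ put $$\theta_j=\theta_j(x,t)=i\left(c_1\lambda_j x+c_2\lambda_j^3t+c_3\lambda_j^2t\right),$$ and let $M=M(x,t)=(m_{kj})_{N\times N}$ be the matrix with entries $$m_{kj}=\frac{\alpha_k^*\alpha_je^{-2(\theta_k^*+\theta_j)}+\left(\beta_k^*\beta_j+\gamma_k^*\gamma_j+1\right)e^{\theta_k^*+\theta_j}}{\lambda_j-\lambda_k^*}.$$ Then the functions $$q_1=3ic_1\sum_{k=1}^N\sum_{j=1}^N\alpha_k\beta_j^*e^{-2\theta_k+\theta_j^*}(M^{-1})_{kj},$$ $$q_2=3ic_1\sum_{k=1}^N\sum_{j=1}^N\alpha_k\gamma_j^*e^{-2\theta_k+\theta_j^*}(M^{-1})_{kj},$$ $$q_3=3ic_1\sum_{k=1}^N\sum_{j=1}^N\alpha_ke^{-2\theta_k+\theta_j^*}(M^{-1})_{kj}$$ are a solution (the $N$-soliton solution) of the three-component coupled Hirota equations with parameter $\epsilon$.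
   Context: Here $^*$ denotes complex conjugation. The three-component coupled Hirota equations with real parameter $\epsilon$, for complex-valued functions $q_1,q_2,q_3$ of $(x,t)\in\mathbb{R}^2$, are $$iq_{1t}+\tfrac12q_{1xx}+\left(|q_1|^2+|q_2|^2+|q_3|^2\right)q_1+i\epsilon\left[q_{1xxx}+3\left(2|q_1|^2+|q_2|^2+|q_3|^2\right)q_{1x}+3q_1\left(q_2^*q_{2x}+q_3^*q_{3x}\right)\right]=0,$$ $$iq_{2t}+\tfrac12q_{2xx}+\left(|q_1|^2+|q_2|^2+|q_3|^2\right)q_2+i\epsilon\left[q_{2xxx}+3\left(2|q_2|^2+|q_3|^2+|q_1|^2\right)q_{2x}+3q_2\left(q_3^*q_{3x}+q_1^*q_{1x}\right)\right]=0,$$ $$iq_{3t}+\tfrac12q_{3xx}+\left(|q_1|^2+|q_2|^2+|q_3|^2\right)q_3+i\epsilon\left[q_{3xxx}+3\left(2|q_3|^2+|q_1|^2+|q_2|^2\right)q_{3x}+3q_3\left(q_1^*q_{1x}+q_2^*q_{2x}\right)\right]=0.$$ *)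

(* Defs.v *)
From mathcomp Require Import all_boot all_order all_algebra.
From mathcomp Require Import complex.
From mathcomp Require Import all_classical all_reals all_analysis.
Set Implicit Arguments.
Unset Strict Implicit.
Unset Printing Implicit Defensive.
Import Order.TTheory GRing.Theory Num.Theory.
Import numFieldNormedType.Exports.
Local Open Scope ring_scope.
Local Open Scope complex_scope.

Definition cexp (R : realType) (z : R[i]) : R[i] :=
  (expR (complex.Re z))%:C * (cos (complex.Im z) +i* sin (complex.Im z)).

(* [R[i]] carries no normed [R]-module structure in the libraries, so functions
   of a real variable with values in [R[i]] are differentiated componentwise. *)
Definition cderivable (R : realType) (f : R -> R[i]) (s : R) : Prop :=
  derivable (fun r => complex.Re (f r)) s 1 /\
  derivable (fun r => complex.Im (f r)) s 1.

Definition cderive (R : realType) (f : R -> R[i]) (s : R) : R[i] :=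
  derive1 (fun r => complex.Re (f r)) s +i* derive1 (fun r => complex.Im (f r)) s.

Definition dx (R : realType) (q : R -> R -> R[i]) (x t : R) : R[i] :=
  cderive (fun y => q y t) x.

Definition dt (R : realType) (q : R -> R -> R[i]) (x t : R) : R[i] :=
  cderive (fun s => q x s) t.

(* [cderive] is total: this says that the derivatives q_t, q_x, q_xx, q_xxx
   exist at every point of the plane. *)
Definition has_derivatives (R : realType) (q : R -> R -> R[i]) : Prop :=
  forall x t : R,
    [/\ cderivable (fun s => q x s) t,
        cderivable (fun y => q y t) x,
        cderivable (fun y => dx q y t) x &
        cderivable (fun y => dx (dx q) y t) x].

(* The equation for the component [q]; the system is invariant under cyclic
   permutations of its components, and [r], [s] are the next two in that
   order. The norm [`|z|] of [z : R[i]] is itself an element of [R[i]]. *)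
Definition hirota_eq (R : realType) (eps : R) (q r s : R -> R -> R[i]) : Prop :=
  forall x t : R,
    'i%C * dt q x t + 2^-1 * dx (dx q) x t
    + (`|q x t| ^+ 2 + `|r x t| ^+ 2 + `|s x t| ^+ 2) * q x t
    + 'i%C * eps%:C *
      (dx (dx (dx q)) x t
       + 3 * (2 * `|q x t| ^+ 2 + `|r x t| ^+ 2 + `|s x t| ^+ 2) * dx q x t
       + 3 * q x t * ((r x t)^* * dx r x t + (s x t)^* * dx s x t)) = 0.

Definition hirota_solution (R : realType) (eps : R)
    (q1 q2 q3 : R -> R -> R[i]) : Prop :=
  [/\ has_derivatives q1, has_derivatives q2 & has_derivatives q3] /\
  [/\ hirota_eq eps q1 q2 q3, hirota_eq eps q2 q3 q1 & hirota_eq eps q3 q1 q2].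

Definition c1 (R : realType) (eps : R) : R := (12 * eps)^-1.
Definition c2 (R : realType) (eps : R) : R := (192 * eps ^+ 2)^-1.
Definition c3 (R : realType) (eps : R) : R := (96 * eps ^+ 2)^-1.

Definition theta (R : realType) (eps : R) (l : R[i]) (x t : R) : R[i] :=
  'i%C * ((c1 eps)%:C * l * x%:C + (c2 eps)%:C * l ^+ 3 * t%:C
        + (c3 eps)%:C * l ^+ 2 * t%:C).

Definition soliton_mx (R : realType) (eps : R) (N : nat)
    (lambda alpha beta gamma : 'I_N -> R[i]) (x t : R) : 'M[R[i]]_N :=
  \matrix_(k < N, j < N)
    (((alpha k)^* * alpha j
        * cexp (- 2 * ((theta eps (lambda k) x t)^* + theta eps (lambda j) x t))
      + ((beta k)^* * beta j + (gamma k)^* * gamma j + 1)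
        * cexp ((theta eps (lambda k) x t)^* + theta eps (lambda j) x t))
     / (lambda j - (lambda k)^*)).

(* q_1, q_2, q_3 are obtained with [w] equal to [beta], [gamma] and the
   constant 1, respectively. *)
Definition soliton (R : realType) (eps : R) (N : nat)
    (lambda alpha beta gamma w : 'I_N -> R[i]) (x t : R) : R[i] :=
  3 * 'i%C * (c1 eps)%:C *
  \sum_(k < N) \sum_(j < N)
    alpha k * (w j)^*
    * cexp (- 2 * theta eps (lambda k) x t + (theta eps (lambda j) x t)^*)
    * invmx (soliton_mx eps lambda alpha beta gamma x t) k j.

(* Main.v *)
(** After the factors [e^(theta_j)] are scaled out, [M] has the entries
    [(conj r_k r_j + W_k^H W_j) / (lambda_j - conj lambda_k)], where the row
    [r_j = alpha_j e^(-3 theta_j)] carries all the dependence on [x] and [t] and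
    [W_j = (beta_j, gamma_j, 1)^T] is constant; the solitons become
    [3 i c_1 r M^-1 w^H] for the rows [w] of [W]. With [K = diag(lambda)], the
    Lyapunov identity [M K - K^H M = r^H r + W^H W] and the rank-one form of
    [M_x] make the quantities [a_n = r K^n M^-1 r^H] and [b_n = r K^n M^-1 w^H]
    satisfy a closed hierarchy of differential equations, and the Hirota
    equations become polynomial identities in [a_n], [b_n] and their conjugates.
    [M] is invertible because [i M] is a sum of Cauchy forms, which are positive
    definite for distinct nodes in the upper half-plane. *)
Require Import Defs.
From mathcomp Require Import all_boot all_order all_algebra.
From mathcomp Require Import complex.
From mathcomp Require Import all_classical all_reals all_analysis.
From mathcomp Require Import ring.
Set Implicit Arguments.
Unset Strict Implicit.
Unset Printing Implicit Defensive.
Import Order.TTheory GRing.Theory Num.Theory.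
Import numFieldNormedType.Exports.
Local Open Scope complex_scope.
Local Open Scope ring_scope.

(** * Derivatives of complex-valued functions of a real variable *)

Section ComplexDerivative.
Variable R : realType.
Implicit Types (f g : R -> R[i]) (x : R) (k l : R[i]).

Lemma is_derive_congr (f g : R -> R) (x k l : R) :
  f =1 g -> is_derive x 1 f k -> k = l -> is_derive x 1 g l.
Proof. by move=> /funext -> + <-. Qed.

Definition is_cderive f x l : Prop :=
  is_derive x 1 (fun y => complex.Re (f y)) (complex.Re l) /\
  is_derive x 1 (fun y => complex.Im (f y)) (complex.Im l).

Lemma is_cderive_derivable f x l : is_cderive f x l -> cderivable f x.
Proof. by case=> -[? _] [? _]. Qed.

Lemma is_cderive_val f x l : is_cderive f x l -> cderive f x = l.
Proof.
case=> dRe dIm; rewrite /cderive !derive1E.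
rewrite (@derive_val _ _ _ _ _ _ _ dRe) (@derive_val _ _ _ _ _ _ _ dIm).
by case: l {dRe dIm}.
Qed.

Lemma cderivableP f x : cderivable f x -> is_cderive f x (cderive f x).
Proof. by case=> dRe dIm; split; rewrite /= derive1E; apply/derivableP. Qed.

Lemma is_cderive_eq f x k l : is_cderive f x k -> k = l -> is_cderive f x l.
Proof. by move=> + <-. Qed.

Lemma is_cderive_ext f g x l : f =1 g -> is_cderive f x l -> is_cderive g x l.
Proof. by move=> /funext ->. Qed.

Lemma is_cderive_unique f x k l :
  is_cderive f x k -> is_cderive f x l -> k = l.
Proof. by move=> /is_cderive_val <- /is_cderive_val <-. Qed.

Lemma is_cderive_cst k x : is_cderive (fun=> k) x 0.
Proof. by split; apply: is_derive_cst. Qed.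

Lemma is_cderiveD f g x k l : is_cderive f x k -> is_cderive g x l ->
  is_cderive (fun y => f y + g y) x (k + l).
Proof.
move=> [fRe fIm] [gRe gIm]; split.
  have := is_deriveD fRe gRe; congr (is_derive _ _ _ _); last first.
    by case: k l {fRe fIm gRe gIm} => ? ? [].
  by apply/funext => y /=; rewrite fctE; case: (f y) (g y) => ? ? [].
have := is_deriveD fIm gIm; congr (is_derive _ _ _ _); last first.
  by case: k l {fRe fIm gRe gIm} => ? ? [].
by apply/funext => y /=; rewrite fctE; case: (f y) (g y) => ? ? [].
Qed.

Lemma is_cderiveM f g x k l : is_cderive f x k -> is_cderive g x l ->
  is_cderive (fun y => f y * g y) x (k * g x + f x * l).
Proof.
move=> [fRe fIm] [gRe gIm]; split.
  have := is_deriveB (is_deriveM fRe gRe) (is_deriveM fIm gIm).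
  congr (is_derive _ _ _ _).
    by apply/funext => y /=; rewrite !fctE; case: (f y) (g y) => ? ? [].
  case: k l (f x) (g x) {fRe fIm gRe gIm} => k1 k2 [l1 l2] [f1 f2] [g1 g2].
  by rewrite /= /GRing.scale /=; ring.
have := is_deriveD (is_deriveM fRe gIm) (is_deriveM fIm gRe).
congr (is_derive _ _ _ _).
  apply/funext => y /=; rewrite !fctE.
  by case: (f y) (g y) => ? ? [] * /=; ring.
case: k l (f x) (g x) {fRe fIm gRe gIm} => k1 k2 [l1 l2] [f1 f2] [g1 g2].
by rewrite /= /GRing.scale /=; ring.
Qed.

Lemma is_cderiveZ c f x l : is_cderive f x l ->
  is_cderive (fun y => c * f y) x (c * l).
Proof.
move=> df; apply: is_cderive_eq (is_cderiveM (is_cderive_cst c x) df) _.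
by rewrite mul0r add0r.
Qed.

Lemma is_cderiveB f g x k l : is_cderive f x k -> is_cderive g x l ->
  is_cderive (fun y => f y - g y) x (k - l).
Proof.
move=> df dg; have dfg := is_cderiveD df (is_cderiveZ (-1) dg).
apply: is_cderive_eq (is_cderive_ext _ dfg) _.
  by move=> y; rewrite mulN1r.
by rewrite mulN1r.
Qed.

(** Both conjugates, multiplied by [z], give [|z|^2], and a nonzero [z] can be cancelled. *)
Lemma conjCc (z : R[i]) : z^* = conjc z.
Proof.
have [->|z0] := eqVneq z 0; first by rewrite !rmorph0.
by apply: (mulfI z0); rewrite -normCK sqr_normc.
Qed.

Lemma is_cderive_conj f x l : is_cderive f x l ->
  is_cderive (fun y => (f y)^*) x l^*.
Proof.
move=> [fRe fIm]; split.
  move: fRe; congr (is_derive _ _ _ _); last by rewrite conjCc; case: (l).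
  by apply/funext => y; rewrite conjCc; case: (f y).
have := is_deriveN fIm; congr (is_derive _ _ _ _).
  by apply/funext => y; rewrite fctE conjCc; case: (f y).
by rewrite conjCc; case: (l).
Qed.

Lemma is_cderive_sum (I : finType) (F : I -> R -> R[i]) (L : I -> R[i]) x :
  (forall i, is_cderive (F i) x (L i)) ->
  is_cderive (fun y => \sum_i F i y) x (\sum_i L i).
Proof.
move=> dF; elim: (index_enum I) => [|i s IHs].
  apply: is_cderive_eq (is_cderive_ext _ (is_cderive_cst 0 x)) _ => [y|];
  by rewrite big_nil.
apply: is_cderive_eq (is_cderive_ext _ (is_cderiveD (dF i) IHs)) _ => [y|];
by rewrite big_cons.
Qed.

Lemma cderivable_prod (I : finType) (F : I -> R -> R[i]) x :
  (forall i, cderivable (F i) x) -> cderivable (fun y => \prod_i F i y) x.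
Proof.
move=> dF; elim: (index_enum I) => [|i s IHs].
  apply: is_cderive_derivable (is_cderive_ext _ (is_cderive_cst 1 x)) => y.
  by rewrite big_nil.
have dFs := is_cderiveM (cderivableP (dF i)) (cderivableP IHs).
apply: is_cderive_derivable (is_cderive_ext _ dFs) => y.
by rewrite big_cons.
Qed.

(** [1/f = conj f / (f * conj f)] has a real denominator, so the real rule for reciprocals applies.
    Existence is enough: the derivative of a matrix inverse is computed later from [F^-1 F = 1]. *)
Lemma cderivable_inv f x : f x != 0 -> cderivable f x ->
  cderivable (fun y => (f y)^-1) x.
Proof.
move=> fx0 /cderivableP df.
have [/is_deriveV dn _] := is_cderiveM df (is_cderive_conj df).
have nE y : complex.Re (f y * (f y)^*) =
    complex.Re (f y) ^+ 2 + complex.Im (f y) ^+ 2.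
  by rewrite conjCc; case: (f y) => a b /=; rewrite mulrN opprK.
have n0 : complex.Re (f x * (f x)^*) != 0.
  rewrite nE; move: fx0; case: (f x) => a b; rewrite eq_complex /=.
  by rewrite paddr_eq0 ?sqr_ge0 // !sqrf_eq0.
have {dn} := dn n0; set L := (X in is_derive _ _ _ X) => dn.
have dn' : is_cderive (fun y => (complex.Re (f y * (f y)^*))^-1%:C) x L%:C.
  by split => //=; apply: is_derive_cst.
have dnf := is_cderiveM dn' (is_cderive_conj df).
apply: is_cderive_derivable (is_cderive_ext _ dnf) => y.
rewrite nE conjCc; case: (f y) => a b.
apply/eqP; rewrite eq_complex /= !mul0r subr0 addr0 !mulrN.
by rewrite ![_^-1 * _]mulrC !eqxx.
Qed.

(** * The complex exponential *)

Lemma cexpD (z w : R[i]) : cexp (z + w) = cexp z * cexp w.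
Proof.
case: z w => a b [c d]; rewrite /cexp /= expRD cosD sinD.
apply/eqP; rewrite eq_complex /= !mul0r !subr0 !addr0.
by apply/andP; split; apply/eqP; ring.
Qed.

Lemma conj_cexp (z : R[i]) : (cexp z)^* = cexp z^*.
Proof.
rewrite !conjCc; case: z => a b; rewrite /cexp /= cosN sinN.
apply/eqP; rewrite eq_complex /= !mul0r !subr0 !addr0.
by apply/andP; split; apply/eqP; ring.
Qed.

Lemma cexp0 : cexp (0 : R[i]) = 1.
Proof. by rewrite /cexp /= expR0 cos0 sin0 mul1r. Qed.

Lemma cexp_neq0 (z : R[i]) : cexp z != 0.
Proof.
apply/negP => /eqP z0; have := cexpD z (- z).
by rewrite subrr cexp0 z0 mul0r; apply/eqP; rewrite oner_neq0.
Qed.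

(** An affine exponent serves both variables, since [theta] is affine in [x] and in [t]. *)
Lemma is_cderive_cexp (k l : R[i]) x :
  is_cderive (fun y => cexp (k * y%:C + l)) x (k * cexp (k * x%:C + l)).
Proof.
case: k l => a b [c d].
have lin (u v : R) : is_derive x 1 (fun y => u * y + v) u.
  have := is_deriveD (is_deriveZ u (is_derive_id x 1)) (is_derive_cst v x 1).
  by rewrite /GRing.scale /= mulr1 addr0.
have comp (h : R -> R) (h' u v : R) (dh : is_derive (u * x + v) 1 h h') :=
  @is_derive1_comp R h (fun y => u * y + v) x _ _ dh (lin u v).
have de := comp _ _ _ _ (is_derive_expR (a * x + c)).
have dc := comp _ _ _ _ (is_derive_cos (b * x + d)).
have ds := comp _ _ _ _ (is_derive_sin (b * x + d)).
split.
  apply: is_derive_congr (is_deriveM de dc) _ => [y|].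
    by rewrite fctE /= ?(mulr0, mul0r, addr0, subr0, add0r).
  by rewrite /= /GRing.scale /= ?(mulr0, mul0r, addr0, subr0, add0r); ring.
apply: is_derive_congr (is_deriveM de ds) _ => [y|].
  by rewrite fctE /= ?(mulr0, mul0r, addr0, subr0, add0r).
by rewrite /= /GRing.scale /= ?(mulr0, mul0r, addr0, subr0, add0r); ring.
Qed.

End ComplexDerivative.

(** * Derivatives of matrix-valued functions *)

Section MatrixDerivative.
Variable R : realType.
Implicit Types (x : R).

Definition is_mxderive m n (F : R -> 'M[R[i]]_(m, n)) x (L : 'M[R[i]]_(m, n)) :=
  forall i j, is_cderive (fun y => F y i j) x (L i j).

Lemma is_mxderive_cst m n (A : 'M[R[i]]_(m, n)) x : is_mxderive (fun=> A) x 0.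
Proof. by move=> i j; rewrite mxE; exact: is_cderive_cst. Qed.

Lemma is_mxderiveM m n p (F : R -> 'M[R[i]]_(m, n)) (G : R -> 'M[R[i]]_(n, p))
    x A B : is_mxderive F x A -> is_mxderive G x B ->
  is_mxderive (fun y => F y *m G y) x (A *m G x + F x *m B).
Proof.
move=> dF dG i j; rewrite !mxE -big_split /=.
apply: is_cderive_ext (is_cderive_sum (fun k => is_cderiveM (dF i k) (dG k j))).
by move=> y; rewrite mxE.
Qed.

Lemma is_mxderiveMr m n p (F : R -> 'M[R[i]]_(m, n)) (B : 'M[R[i]]_(n, p)) x A :
  is_mxderive F x A -> is_mxderive (fun y => F y *m B) x (A *m B).
Proof.
by move=> /is_mxderiveM/(_ (is_mxderive_cst B x)); rewrite mulmx0 addr0.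
Qed.

Lemma cderivableM (f g : R -> R[i]) x :
  cderivable f x -> cderivable g x -> cderivable (fun y => f y * g y) x.
Proof.
by move=> /cderivableP df /cderivableP dg;
  exact: is_cderive_derivable (is_cderiveM df dg).
Qed.

Lemma cderivable_det n (F : R -> 'M[R[i]]_n) x :
  (forall i j, cderivable (fun y => F y i j) x) ->
  cderivable (fun y => \det (F y)) x.
Proof.
move=> dF; apply/is_cderive_derivable/is_cderive_sum => s.
apply/cderivableP/cderivableM.
  exact: is_cderive_derivable (is_cderive_cst _ _).
exact: cderivable_prod.
Qed.

(** By Cramer's rule each entry is a cofactor over the determinant, both polynomial in the entries
    of [F]. *)
Lemma cderivable_invmx n (F : R -> 'M[R[i]]_n) x :
  (forall y, F y \in unitmx) ->
  (forall i j, cderivable (fun y => F y i j) x) ->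
  forall i j, cderivable (fun y => invmx (F y) i j) x.
Proof.
move=> Fu dF i j.
have -> : (fun y => invmx (F y) i j) =
    (fun y => (\det (F y))^-1 *
      ((-1) ^+ (j + i) * \det (row' j (col' i (F y))))).
  by apply/funext => y; rewrite /invmx Fu !mxE.
apply: cderivableM.
  by apply: cderivable_inv; [rewrite -unitfE; exact: Fu|exact: cderivable_det].
apply: cderivableM; first exact: is_cderive_derivable (is_cderive_cst _ _).
apply: cderivable_det => k l.
have -> : (fun y => row' j (col' i (F y)) k l) =
    (fun y => F y (lift j k) (lift i l)) by apply/funext => y; rewrite !mxE.
exact: dF.
Qed.

(** The inverse being differentiable, differentiating [F^-1 F = 1] and multiplying by [F^-1] on the
    right determines its derivative. *)
Lemma is_mxderive_inv n (F : R -> 'M[R[i]]_n) x A :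
  (forall y, F y \in unitmx) -> is_mxderive F x A ->
  is_mxderive (fun y => invmx (F y)) x (- (invmx (F x) *m A *m invmx (F x))).
Proof.
move=> Fu dF.
pose L : 'M[R[i]]_n := \matrix_(i, j) cderive (fun y => invmx (F y) i j) x.
have dI : is_mxderive (fun y => invmx (F y)) x L.
  move=> i j; rewrite mxE; apply/cderivableP/cderivable_invmx => // k l.
  exact: is_cderive_derivable (dF k l).
have LF : L *m F x + invmx (F x) *m A = 0.
  apply/matrixP => i j; apply: (is_cderive_unique (is_mxderiveM dI dF i j)).
  apply: is_cderive_ext (is_mxderive_cst (1%:M : 'M[R[i]]_n) x i j) => y.
  by rewrite mulVmx.
suff <- : L = - (invmx (F x) *m A *m invmx (F x)) by [].
move/eqP: LF; rewrite addr_eq0 => /eqP/(congr1 (mulmx^~ (invmx (F x)))).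
by rewrite mulmxK // mulNmx.
Qed.

End MatrixDerivative.

(** * Positivity of the Cauchy form *)

Section CauchyForm.
Variable C : numClosedFieldType.

(** For nodes in the upper half-plane this is the integral of [|sum_j u_j e^(i l_j s)|^2] over
    [s >= 0], the Gram form of decaying exponentials. *)
Definition cauchy_form n (l u : 'I_n -> C) : C :=
  \sum_k \sum_j (u k)^* * u j * ('i / (l j - (l k)^*)).

Lemma subr_conj_neq0 (z w : C) : 0 < 'Im z -> 0 < 'Im w -> z - w^* != 0.
Proof.
move=> z_gt0 w_gt0; apply/negP => /eqP/(congr1 (fun v : C => 'Im v)).
rewrite raddfB /= Im_conj opprK raddf0 => /eqP; apply/negP.
by rewrite gt_eqF // addr_gt0.
Qed.

(* Schur complement with respect to the first node: what remains is the form of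
   the other nodes, its vector multiplied by a Blaschke factor. *)
Lemma cauchy_form_recl n (l u : 'I_n.+1 -> C) : (forall j, 0 < 'Im (l j)) ->
  cauchy_form l u =
    2 * 'Im (l ord0) * `|\sum_j u j / (l j - (l ord0)^*)| ^+ 2 +
    cauchy_form (fun j => l (lift ord0 j))
      (fun j => u (lift ord0 j) *
         ((l (lift ord0 j) - l ord0) / (l (lift ord0 j) - (l ord0)^*))).
Proof.
move=> l_gt0; have l0 j k := subr_conj_neq0 (l_gt0 j) (l_gt0 k).
set v := fun j => u j * ((l j - l ord0) / (l j - (l ord0)^*)).
(* The Blaschke factor vanishes at the first node, so that node can be put back into the form, and
   the identity holds term by term. *)
have -> : cauchy_form (fun j => l (lift ord0 j)) (fun j => v (lift ord0 j)) =
    cauchy_form l v.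
  rewrite /cauchy_form [RHS]big_ord_recl [X in _ = X + _]big1 ?add0r;
    last first.
    by move=> j _; rewrite /v subrr mul0r mulr0 rmorph0 !mul0r.
  apply: eq_bigr => k _; rewrite [RHS]big_ord_recl /v subrr.
  by rewrite mul0r mulr0 mulr0 mul0r add0r.
rewrite normCK rmorph_sum [X in _ * X]mulrC mulr_suml mulr_sumr -big_split /=.
apply: eq_bigr => k _; rewrite mulr_sumr mulr_sumr -big_split /=.
apply: eq_bigr => j _.
have ImE : 2 * 'Im (l ord0) = 'i * ((l ord0)^* - l ord0).
  by rewrite ImE; field.
rewrite ImE /v !rmorphM !fmorphV !rmorphB /= !conjCK.
have h1 := l0 j k; have h2 := l0 j ord0.
have h3 : (l k)^* - l ord0 != 0 by rewrite -oppr_eq0 opprB.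
by field; rewrite h1 h2 h3.
Qed.

Lemma cauchy_form_ge0 n (l u : 'I_n -> C) :
  (forall j, 0 < 'Im (l j)) -> 0 <= cauchy_form l u.
Proof.
elim: n l u => [|n IHn] l u l_gt0; first by rewrite /cauchy_form big_ord0.
rewrite cauchy_form_recl // addr_ge0 ?IHn //.
by rewrite !mulr_ge0 ?exprn_ge0 ?ler0n // ltW.
Qed.

(** Both nonnegative summands of the recursion vanish. For distinct nodes the Blaschke factors at
    the other nodes are nonzero, so induction kills those [u j]; the square then contains the first
    one only. *)
Lemma cauchy_form_eq0 n (l u : 'I_n -> C) :
  injective l -> (forall j, 0 < 'Im (l j)) -> cauchy_form l u = 0 ->
  forall j, u j = 0.
Proof.
elim: n l u => [|n IHn] l u l_inj l_gt0; first by move=> _ [].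
rewrite cauchy_form_recl // => /eqP; rewrite paddr_eq0; first last.
- exact: cauchy_form_ge0.
- by rewrite !mulr_ge0 ?exprn_ge0 ?ler0n // ltW.
case/andP=> + /eqP/IHn u0.
have {}u0 j : u (lift ord0 j) = 0.
  have /eqP := u0 (inj_comp l_inj lift_inj) (fun j => l_gt0 _) j.
  rewrite mulf_eq0 => /orP[/eqP //|]; rewrite mulf_eq0 invr_eq0.
  rewrite (negPf (subr_conj_neq0 _ _)) // orbF subr_eq0 => /eqP/l_inj/eqP.
  by rewrite lift_eqF.
rewrite big_ord_recl big1 ?addr0 => [|j _]; last by rewrite u0 mul0r.
rewrite mulf_eq0 mulf_eq0 pnatr_eq0 (gt_eqF (l_gt0 ord0)) /= expf_eq0 /=.
rewrite normr_eq0 mulf_eq0 invr_eq0.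
rewrite (negPf (subr_conj_neq0 _ _)) // orbF => /eqP u00 j.
have [i ->|->] := unliftP ord0 j; [exact: u0|exact: u00].
Qed.

End CauchyForm.

(** * The hierarchy implies the Hirota equations *)

Section HirotaFlow.
Variables (R : realType) (eps : R).
Hypothesis eps_neq0 : eps != 0.

(** The exponent [-3 theta_j] of the row [r] is [kappa lambda_j x + kappa2 lambda_j^3 t + kappa3
    lambda_j^2 t]. *)
Let kappa : R[i] := - 3 * 'i%C * (c1 eps)%:C.
Let kappa2 : R[i] := - 3 * 'i%C * (c2 eps)%:C.
Let kappa3 : R[i] := - 3 * 'i%C * (c3 eps)%:C.

Lemma kappa_neq0 : kappa != 0.
Proof.
rewrite /kappa mulf_neq0 //; last first.
  by rewrite fmorph_eq0 invr_eq0 mulf_neq0 ?pnatr_eq0.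
rewrite mulf_neq0 ?oppr_eq0 ?pnatr_eq0 //.
by rewrite eq_complex /= oner_eq0 andbF.
Qed.

Lemma conj_im_scalar (c : R) : (- 3 * 'i%C * c%:C)^* = - (- 3 * 'i%C * c%:C).
Proof.
rewrite !rmorphM rmorphN rmorph_nat /= !conjCc conjc_real.
have -> : conjc 'i%C = - 'i%C :> R[i].
  by apply/eqP; rewrite eq_complex /= oppr0 !eqxx.
by ring.
Qed.

Lemma kappa_conj : kappa^* = - kappa.
Proof. exact: conj_im_scalar. Qed.

Lemma iM_kappa (c : R) : 'i%C * (- 3 * 'i%C * c%:C) = 3 * c%:C :> R[i].
Proof.
transitivity (- 3 * ('i%C ^+ 2) * c%:C : R[i]); first by ring.
by rewrite sqr_i; ring.
Qed.

Lemma sqr_kappa : kappa ^+ 2 = - (16 * eps%:C ^+ 2)^-1.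
Proof.
transitivity (9 * ('i%C ^+ 2) * (c1 eps)%:C ^+ 2 : R[i]).
  by rewrite /kappa; ring.
rewrite sqr_i /c1 fmorphV rmorphM rmorph_nat /=; field.
by rewrite fmorph_eq0.
Qed.

(* In terms of [kappa], the coefficients of the equation no longer contain ['i]. *)
Lemma i_kappa2 : 'i%C * kappa2 = - kappa ^+ 2 / 4.
Proof.
rewrite iM_kappa sqr_kappa /c2 fmorphV rmorphM rmorphXn rmorph_nat /=; field.
by rewrite fmorph_eq0.
Qed.

Lemma i_kappa3 : 'i%C * kappa3 = - kappa ^+ 2 / 2.
Proof.
rewrite iM_kappa sqr_kappa /c3 fmorphV rmorphM rmorphXn rmorph_nat /=; field.
by rewrite fmorph_eq0.
Qed.

Lemma i_eps : 'i%C * eps%:C = (4 * kappa)^-1.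
Proof.
have k0 : 4 * kappa != 0 by rewrite mulf_neq0 ?kappa_neq0 ?pnatr_eq0.
apply: (mulIf k0); rewrite mulVf //.
transitivity (- 12 * ('i%C ^+ 2) * (eps%:C * (c1 eps)%:C) : R[i]).
  by rewrite /kappa; ring.
rewrite sqr_i /c1 fmorphV rmorphM rmorph_nat /=; field.
by rewrite fmorph_eq0.
Qed.

(* In the application [a n] and [b n], for [b] one of [u], [v], [w], are the
   pairings [r K^n M^-1 r^H] and [r K^n M^-1 w_b^H]. *)
Section FirstComponent.
Variables (a u v w : nat -> R -> R -> R[i]) (S : nat -> nat -> R -> R -> R[i]).

Definition flow_x (b : nat -> R -> R -> R[i]) := forall n x t,
  is_cderive (fun y => b n y t) x (kappa * (b n.+1 x t - a n x t * b 0 x t)).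

(* By the Lyapunov identity, [flow_rho1] and [flow_rho2] are the pairings
   [r M^-1 K^H r^H] and [r M^-1 (K^H)^2 r^H]. *)
Definition flow_rho1 x t := a 1 x t - a 0 x t ^+ 2 + S 0 0 x t.
Definition flow_rho2 x t :=
  a 2 x t - a 1 x t * a 0 x t + S 1 0 x t - a 0 x t * flow_rho1 x t + S 0 1 x t.

(** The flow [r_t = kappa2 r K^3 + kappa3 r K^2] seen on the pairings, at level 0, which carries
    [q_t]. *)
Definition flow_t (b : nat -> R -> R -> R[i]) := forall x t,
  is_cderive (fun s => b 0 x s) t
    (kappa2 * (b 3 x t - a 0 x t * b 2 x t - flow_rho1 x t * b 1 x t
               - flow_rho2 x t * b 0 x t)
     + kappa3 * (b 2 x t - a 0 x t * b 1 x t - flow_rho1 x t * b 0 x t)).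

(** [S] is a parameter tied down by this equation, so that a cyclic permutation of [u], [v], [w]
    keeps [S], and with it [flow_t], unchanged. *)
Hypothesis S_E : forall n m x t, S n m x t =
  u n x t * (u m x t)^* + v n x t * (v m x t)^* + w n x t * (w m x t)^*.
Hypothesis a_conj : forall x t, (a 0 x t)^* = - a 0 x t.
Hypothesis a_x : forall n x t,
  is_cderive (fun y => a n y t) x (- kappa * S n 0 x t).
Hypotheses (u_x : flow_x u) (v_x : flow_x v) (w_x : flow_x w) (u_t : flow_t u).

Lemma flow_x_conj b n x t : flow_x b -> is_cderive (fun y => (b n y t)^*) x
  (- kappa * ((b n.+1 x t)^* - (a n x t)^* * (b 0 x t)^*)).
Proof.
move=> /(_ n x t)/is_cderive_conj db; apply: is_cderive_eq db _.
by rewrite rmorphM /= kappa_conj rmorphB rmorphM.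
Qed.

(** Product rule on each [b_n * conj b_0]; since [a 0] is imaginary, its conjugate contributes the
    term [- a 0 * S n 0]. *)
Lemma flow_s n x t : is_cderive (fun y => S n 0 y t) x
  (kappa * (S n.+1 0 x t - a n x t * S 0 0 x t - a 0 x t * S n 0 x t)
   - kappa * S n 1 x t).
Proof.
have d (b : nat -> R -> R -> R[i]) (b_x : flow_x b) :=
  is_cderiveM (b_x n x t) (flow_x_conj 0 x t b_x).
have dS := is_cderiveD (is_cderiveD (d u u_x) (d v v_x)) (d w w_x).
apply: is_cderive_eq (is_cderive_ext (fun y => esym (S_E n 0 y t)) dS) _.
by rewrite a_conj !S_E; ring.
Qed.

(** Closed forms of the [x]-derivatives: each follows from the previous one by the hierarchy, with
    [flow_s] entering at the third order. *)
Let q x t := - kappa * u 0 x t.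
Let q_x x t := - kappa ^+ 2 * (u 1 x t - a 0 x t * u 0 x t).
Let q_xx x t := - kappa ^+ 3 *
  (u 2 x t - a 1 x t * u 0 x t + S 0 0 x t * u 0 x t - a 0 x t * u 1 x t
   + a 0 x t ^+ 2 * u 0 x t).

Lemma flow_dx (b : nat -> R -> R -> R[i]) x t : flow_x b ->
  is_cderive (fun y => - kappa * b 0 y t) x
    (- kappa ^+ 2 * (b 1 x t - a 0 x t * b 0 x t)).
Proof.
move=> b_x; apply: is_cderive_eq (is_cderiveZ (- kappa) (b_x 0 x t)) _.
by ring.
Qed.

Lemma flow_dxE (b : nat -> R -> R -> R[i]) : flow_x b ->
  dx (fun x t => - kappa * b 0 x t) =
  fun x t => - kappa ^+ 2 * (b 1 x t - a 0 x t * b 0 x t).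
Proof.
move=> b_x; apply/funext => x; apply/funext => t.
exact/is_cderive_val/flow_dx.
Qed.

Lemma flow_dxx x t : is_cderive (fun y => q_x y t) x (q_xx x t).
Proof.
have d := is_cderiveZ (- kappa ^+ 2)
  (is_cderiveB (u_x 1 x t) (is_cderiveM (a_x 0 x t) (u_x 0 x t))).
by apply: is_cderive_eq d _; rewrite /q_xx; ring.
Qed.

Let q_xxx x t := - kappa ^+ 4 *
  (u 3 x t - a 2 x t * u 0 x t - a 1 x t * (u 1 x t - a 0 x t * u 0 x t)
   + (2 * S 1 0 x t - S 0 1 x t) * u 0 x t + 2 * S 0 0 x t * u 1 x t
   - 5 * a 0 x t * S 0 0 x t * u 0 x t
   - a 0 x t * (u 2 x t - a 1 x t * u 0 x t)
   + a 0 x t ^+ 2 * (u 1 x t - a 0 x t * u 0 x t)).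

Lemma flow_dxxx x t : is_cderive (fun y => q_xx y t) x (q_xxx x t).
Proof.
have d := is_cderiveZ (- kappa ^+ 3)
  (is_cderiveD (is_cderiveB (is_cderiveD (is_cderiveB (u_x 2 x t)
    (is_cderiveM (a_x 1 x t) (u_x 0 x t)))
    (is_cderiveM (flow_s 0 x t) (u_x 0 x t)))
    (is_cderiveM (a_x 0 x t) (u_x 1 x t)))
    (is_cderiveM (is_cderiveM (a_x 0 x t) (a_x 0 x t)) (u_x 0 x t))).
by apply: is_cderive_eq d _; rewrite /q_xxx; ring.
Qed.

(** All derivatives are polynomials in the hierarchy, and each term of the equation is [kappa^3]
    times such a polynomial; what remains is a polynomial identity. *)
Lemma flow_hirota_component :
  has_derivatives q /\
  hirota_eq eps q (fun x t => - kappa * v 0 x t) (fun x t => - kappa * w 0 x t).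
Proof.
have qxE : dx q = q_x by exact: flow_dxE.
have qxxE : dx q_x = q_xx.
  by apply/funext => x; apply/funext => t; exact/is_cderive_val/flow_dxx.
have q_t x t := is_cderiveZ (- kappa) (u_t x t).
split=> x t.
  split; rewrite ?qxE ?qxxE; apply: is_cderive_derivable.
  - exact: q_t.
  - exact: flow_dx.
  - exact: flow_dxx.
  - exact: flow_dxxx.
rewrite (flow_dxE v_x) (flow_dxE w_x) qxE qxxE /dx /dt.
rewrite (is_cderive_val (flow_dxxx x t)) (is_cderive_val (q_t x t)) !normCK /q.
have kJ (z : R[i]) : (- kappa * z)^* = kappa * z^*.
  by rewrite rmorphM rmorphN /= kappa_conj opprK.
(* The factor ['i] is brought next to [kappa2], [kappa3] and [eps], where it can be eliminated in
   favour of [kappa]. *)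
rewrite !kJ mulrCA mulrDr !(mulrA 'i%C kappa2) !(mulrA 'i%C kappa3).
rewrite i_kappa2 i_kappa3 i_eps.
rewrite /q_xx /q_xxx /q_x /flow_rho2 /flow_rho1 !S_E.
by field; rewrite kappa_neq0.
Qed.

End FirstComponent.

(** One component suffices up to the three cyclic arrangements, under which the sum defining [S] is
    symmetric. *)
Lemma flow_hirota (a u v w : nat -> R -> R -> R[i]) S :
  (forall n m x t, S n m x t =
     u n x t * (u m x t)^* + v n x t * (v m x t)^* + w n x t * (w m x t)^*) ->
  (forall x t, (a 0 x t)^* = - a 0 x t) ->
  (forall n x t, is_cderive (fun y => a n y t) x (- kappa * S n 0 x t)) ->
  flow_x a u -> flow_x a v -> flow_x a w ->
  flow_t a S u -> flow_t a S v -> flow_t a S w ->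
  hirota_solution eps (fun x t => - kappa * u 0 x t)
    (fun x t => - kappa * v 0 x t) (fun x t => - kappa * w 0 x t).
Proof.
move=> S_E a_conj a_x u_x v_x w_x u_t v_t w_t.
have [du hu] := flow_hirota_component S_E a_conj a_x u_x v_x w_x u_t.
have S_E' n m x t : S n m x t =
    v n x t * (v m x t)^* + w n x t * (w m x t)^* + u n x t * (u m x t)^*.
  by rewrite S_E; ring.
have [dv hv] := flow_hirota_component S_E' a_conj a_x v_x w_x u_x v_t.
have S_E'' n m x t : S n m x t =
    w n x t * (w m x t)^* + u n x t * (u m x t)^* + v n x t * (v m x t)^*.
  by rewrite S_E; ring.
have [dw hw] := flow_hirota_component S_E'' a_conj a_x w_x u_x v_x w_t.
exact: (conj (And3 du dv dw) (And3 hu hv hw)).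
Qed.

End HirotaFlow.

(** * The scaled soliton matrix *)

Section SolitonMatrix.
Variable C : numClosedFieldType.

Definition adjmx m n (A : 'M[C]_(m, n)) : 'M[C]_(n, m) :=
  (map_mx Num.conj A)^T.

Lemma adjmx_mulE n (u v : 'rV[C]_n) k j :
  (adjmx u *m v) k j = (u 0 k)^* * v 0 j.
Proof. by rewrite mxE big_ord1 !mxE. Qed.

Lemma adjmxM m n p (A : 'M[C]_(m, n)) (B : 'M[C]_(n, p)) :
  adjmx (A *m B) = adjmx B *m adjmx A.
Proof. by rewrite /adjmx map_mxM trmx_mul. Qed.

Lemma adjmxK m n (A : 'M[C]_(m, n)) : adjmx (adjmx A) = A.
Proof. by apply/matrixP => i j; rewrite !mxE conjCK. Qed.

Lemma adjmxZ m n c (A : 'M[C]_(m, n)) : adjmx (c *: A) = c^* *: adjmx A.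
Proof. by rewrite /adjmx map_mxZ linearZ. Qed.

Lemma adjmx_inv n (A : 'M[C]_n) : adjmx (invmx A) = invmx (adjmx A).
Proof. by rewrite /adjmx map_invmx trmx_inv. Qed.

Variables (n : nat) (l : 'rV[C]_n) (w1 w2 w3 : 'rV[C]_n).

(* The soliton matrix without the factors [e^(theta_k^* + theta_j)]. *)
Definition dressing_mx (r : 'rV[C]_n) : 'M[C]_n :=
  \matrix_(k, j) (((r 0 k)^* * r 0 j + (w1 0 k)^* * w1 0 j
    + (w2 0 k)^* * w2 0 j + (w3 0 k)^* * w3 0 j) / (l 0 j - (l 0 k)^*)).

Lemma dressing_mx_adj r : adjmx (dressing_mx r) = - dressing_mx r.
Proof.
apply/matrixP => i j; rewrite !mxE !(rmorphM, rmorphD, fmorphV, rmorphB) /=.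
rewrite !conjCK -mulrN -invrN opprB; congr (_ / _); first by ring.
by rewrite rmorphN /= conjCK.
Qed.

Hypothesis l_inj : injective (l 0).
Hypothesis l_gt0 : forall j, 0 < 'Im (l 0 j).

(** If [v M = 0], then [i v M v^H = 0] is a sum of four nonnegative Cauchy forms with vectors
    [p_j conj v_j], [p] one of [r], [w1], [w2], [w3]. The one for [w3] vanishes, hence
    [w3_j conj v_j = 0] and [v = 0], whatever the zeros of [r]. *)
Lemma dressing_mx_unit r : (forall j, w3 0 j != 0) -> dressing_mx r \in unitmx.
Proof.
move=> w3_neq0; rewrite -row_free_unit; apply: inj_row_free => v vM0.
pose form (p : 'rV[C]_n) := cauchy_form (l 0) (fun j => p 0 j * (v 0 j)^*).
have form_ge0 p : 0 <= form p by exact: cauchy_form_ge0.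
have : form r + form w1 + form w2 + form w3 = 0.
  transitivity ('i * (v *m dressing_mx r *m adjmx v) 0 0); last first.
    by rewrite vM0 mul0mx mxE mulr0.
  rewrite /form /cauchy_form -!big_split /= -mulmxA mxE mulr_sumr.
  apply: eq_bigr => k _; rewrite -!big_split /= mxE !mulr_sumr.
  apply: eq_bigr => j _; rewrite !mxE !rmorphM /= conjCK.
  by ring.
move/eqP; rewrite paddr_eq0 ?addr_ge0 // => /andP[_ /eqP/cauchy_form_eq0 v0].
apply/rowP => j; rewrite mxE.
have /eqP := v0 l_inj l_gt0 j.
by rewrite mulf_eq0 (negPf (w3_neq0 j)) conjC_eq0 => /eqP.
Qed.

(** * Pairings and the Lyapunov identity *)

Hypothesis w3_neq0 : forall j, w3 0 j != 0.

Definition shift_row (p : 'rV[C]_n) : 'rV[C]_n := p *m diag_mx l.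

Lemma shift_rowE p j : shift_row p 0 j = p 0 j * l 0 j.
Proof. by rewrite /shift_row mul_mx_diag mxE. Qed.

Definition pairing r (p q : 'rV[C]_n) : C :=
  (p *m invmx (dressing_mx r) *m adjmx q) 0 0.

Lemma dressing_mx_shift r :
  dressing_mx r *m diag_mx l - adjmx (diag_mx l) *m dressing_mx r =
  adjmx r *m r + adjmx w1 *m w1 + adjmx w2 *m w2 + adjmx w3 *m w3.
Proof.
have -> : adjmx (diag_mx l) = diag_mx (map_mx Num.conj l).
  by rewrite /adjmx map_diag_mx tr_diag_mx.
apply/matrixP => k j; rewrite mul_mx_diag mul_diag_mx !mxE !big_ord1 !mxE.
have d0 := subr_conj_neq0 (l_gt0 j) (l_gt0 k).
by field.
Qed.

(** Minus the first-order change of [pairing r p q] when the dressing matrix changes by [A]. For [A]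
    of rank one it splits into a product of two pairings. *)
Definition sandwich r (p q : 'rV[C]_n) (A : 'M[C]_n) : C :=
  (p *m invmx (dressing_mx r) *m A *m invmx (dressing_mx r) *m adjmx q) 0 0.

Lemma sandwichD r p q A B :
  sandwich r p q (A + B) = sandwich r p q A + sandwich r p q B.
Proof. by rewrite /sandwich mulmxDr !mulmxDl mxE. Qed.

Lemma sandwichZ r p q c A : sandwich r p q (c *: A) = c * sandwich r p q A.
Proof. by rewrite /sandwich -scalemxAr -!scalemxAl mxE. Qed.

Lemma sandwich_rank1 r p u v q :
  sandwich r p q (adjmx u *m v) = pairing r p u * pairing r v q.
Proof.
rewrite /sandwich.
have -> : forall A B : 'M[C]_n, p *m A *m (adjmx u *m v) *m B *m adjmx q =
    (p *m A *m adjmx u) *m (v *m B *m adjmx q) by move=> A B; rewrite !mulmxA.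
by rewrite mxE big_ord1.
Qed.

(** The Lyapunov identity multiplied by [Y = M^-1] on both sides expresses [K Y - Y K^H] by rank-one
    terms; this moves [K] from the left argument to the right one. *)
Lemma pairing_shift r p q :
  pairing r (shift_row p) q = pairing r p (shift_row q)
    + pairing r p r * pairing r r q + pairing r p w1 * pairing r w1 q
    + pairing r p w2 * pairing r w2 q + pairing r p w3 * pairing r w3 q.
Proof.
have Mu := dressing_mx_unit r w3_neq0.
rewrite -!sandwich_rank1 /sandwich /pairing.
set M := dressing_mx r in Mu *; set Y := invmx M.
have KY : diag_mx l *m Y = Y *m adjmx (diag_mx l) + Y *m (adjmx r *m r)  *m Y
    + Y *m (adjmx w1 *m w1) *m Y + Y *m (adjmx w2 *m w2) *m Y
    + Y *m (adjmx w3 *m w3) *m Y.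
  have MY : Y *m (M *m diag_mx l) *m Y = diag_mx l *m Y by rewrite mulKmx.
  have YM : Y *m (adjmx (diag_mx l) *m M) *m Y = Y *m adjmx (diag_mx l).
    by rewrite mulmxA mulmxK.
  rewrite -MY -YM -!addrA [RHS]addrC !addrA -!mulmxDl -!mulmxDr.
  by rewrite -dressing_mx_shift subrK.
rewrite /shift_row -(mulmxA p) KY adjmxM.
by rewrite !mulmxDr !mulmxDl !mulmxA !mxE.
Qed.

(** [M] is anti-Hermitian, hence so is its inverse. *)
Lemma pairing_conj r p q : (pairing r p q)^* = - pairing r q p.
Proof.
have -> : (pairing r p q)^* = adjmx (p *m invmx (dressing_mx r) *m adjmx q) 0 0.
  by rewrite [RHS]mxE [in RHS]mxE.
have invN : invmx (- dressing_mx r) = - invmx (dressing_mx r).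
  rewrite -[in LHS]scaleN1r invmxZ ?invrN1 ?scaleN1r //.
  rewrite -dressing_mx_adj -[_ \in _]unitmx_tr trmxK map_unitmx.
  exact: dressing_mx_unit.
rewrite !adjmxM adjmxK adjmx_inv dressing_mx_adj invN.
by rewrite mulNmx mulmxN mulmxA mxE.
Qed.

End SolitonMatrix.

(** * Evolution of the pairings *)

Section SolitonFlow.
Variables (R : realType) (n : nat) (l w1 w2 w3 : 'rV[R[i]]_n).
Hypothesis l_inj : injective (l 0).
Hypothesis l_gt0 : forall j, 0 < 'Im (l 0 j).
Hypothesis w3_neq0 : forall j, w3 0 j != 0.

Local Notation dressing := (dressing_mx l w1 w2 w3).
Local Notation pair := (pairing l w1 w2 w3).
Local Notation shift := (shift_row l).

Lemma pairingDl r p1 p2 q : pair r (p1 + p2) q = pair r p1 q + pair r p2 q.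
Proof. by rewrite /pairing !mulmxDl mxE. Qed.

Lemma pairingZl r c p q : pair r (c *: p) q = c * pair r p q.
Proof. by rewrite /pairing -!scalemxAl mxE. Qed.

Lemma pairingZr r c p q : pair r p (c *: q) = c^* * pair r p q.
Proof. by rewrite /pairing adjmxZ -!scalemxAr mxE. Qed.

Lemma shift_rowZ c p : shift (c *: p) = c *: shift p.
Proof. by rewrite /shift_row -scalemxAl. Qed.

(** Only the numerator [conj r_k r_j] varies. When its derivative has the factor [l_j - conj l_k],
    the Cauchy denominator cancels. *)
Lemma is_mxderive_dressing (r : R -> 'rV[R[i]]_n) s r' (A : 'M[R[i]]_n) :
  is_mxderive r s r' ->
  (forall k j, (r' 0 k)^* * r s 0 j + (r s 0 k)^* * r' 0 j =
     A k j * (l 0 j - (l 0 k)^*)) ->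
  is_mxderive (fun y => dressing (r y)) s A.
Proof.
move=> dr AE k j.
have dkj := is_cderiveM (is_cderive_conj (dr 0 k)) (dr 0 j).
have dw := is_cderive_cst ((w1 0 k)^* * w1 0 j + (w2 0 k)^* * w2 0 j
  + (w3 0 k)^* * w3 0 j) s.
have := is_cderiveZ (l 0 j - (l 0 k)^*)^-1 (is_cderiveD dkj dw).
rewrite addr0 AE [X in is_cderive _ _ X]mulrC mulfK ?subr_conj_neq0 // => d.
by apply: is_cderive_ext d => y; rewrite mxE mulrC !addrA.
Qed.

Lemma is_cderive_pairing (r p q : R -> 'rV[R[i]]_n) s p' q' A :
  is_mxderive (fun y => dressing (r y)) s A ->
  is_mxderive p s p' -> is_mxderive q s q' ->
  is_cderive (fun y => pair (r y) (p y) (q y)) s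
    (pair (r s) p' (q s) - sandwich l w1 w2 w3 (r s) (p s) (q s) A
     + pair (r s) (p s) q').
Proof.
move=> dM dp dq.
have dqa : is_mxderive (fun y => adjmx (q y)) s (adjmx q').
  move=> i j; rewrite !mxE.
  by apply: is_cderive_ext (is_cderive_conj (dq j i)) => y; rewrite !mxE.
have Mu y : dressing (r y) \in unitmx by exact: dressing_mx_unit.
have := is_mxderiveM (is_mxderiveM dp (is_mxderive_inv Mu dM)) dqa.
move=> /(_ 0 0); rewrite mxE mulmxDl mxE mulmxN mulNmx !mulmxA.
by rewrite [X in _ + X + _]mxE.
Qed.

Lemma is_mxderive_shift (p : R -> 'rV[R[i]]_n) s p' :
  is_mxderive p s p' -> is_mxderive (fun y => shift (p y)) s (shift p').
Proof. exact: is_mxderiveMr. Qed.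

Lemma is_mxderive_iter_shift k (p : R -> 'rV[R[i]]_n) s p' :
  is_mxderive p s p' ->
  is_mxderive (fun y => iter k shift (p y)) s (iter k shift p').
Proof. by move=> dp; elim: k => //= k IHk; exact: is_mxderive_shift. Qed.

Lemma iter_shift_rowZ k c p : iter k shift (c *: p) = c *: iter k shift p.
Proof. by elim: k => //= k ->; rewrite shift_rowZ. Qed.

(** Pairings become variables, so that [ring] treats them as atoms. *)
Ltac ring_pairing :=
  repeat match goal with |- context [pairing ?l ?w1 ?w2 ?w3 ?r ?p ?q] =>
    generalize (pairing l w1 w2 w3 r p q); intro
  end; ring.

Section SpaceFlow.
Variables (r : R -> 'rV[R[i]]_n) (s : R) (c : R[i]).
Hypothesis c_conj : c^* = - c.
Hypothesis dr : is_mxderive r s (c *: shift (r s)).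

(** As [c] is imaginary, [conj r_k r_j] has derivative [c (l_j - conj l_k) conj r_k r_j]; cancelling
    the denominator leaves a matrix of rank one. *)
Lemma dressing_x : is_mxderive (fun y => dressing (r y)) s
  (c *: (adjmx (r s) *m r s)).
Proof.
apply: is_mxderive_dressing dr _ => k j.
have ZE m (B : 'M[R[i]]_(m, n)) a i h : (a *: B) i h = a * B i h by rewrite mxE.
rewrite !ZE adjmx_mulE !shift_rowE.
rewrite !rmorphM /= c_conj.
move: (r s 0 k) (r s 0 j) (l 0 k) (l 0 j) => rk rj lk lj.
move: (rk^*) (lk^*) => rk' lk'.
by ring.
Qed.

Lemma pairing_x k q :
  is_cderive (fun y => pair (r y) (iter k shift (r y)) q) s
    (c * (pair (r s) (iter k.+1 shift (r s)) q
          - pair (r s) (iter k shift (r s)) (r s) * pair (r s) (r s) q)).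
Proof.
have := is_cderive_pairing dressing_x (is_mxderive_iter_shift k dr)
  (is_mxderive_cst q s).
move=> d; apply: is_cderive_eq d _.
rewrite sandwichZ sandwich_rank1 iter_shift_rowZ pairingZl -iterSr.
have -> : pair (r s) (iter k shift (r s)) 0 = 0.
  by rewrite -(scale0r (0 : 'rV_n)) pairingZr rmorph0 mul0r.
rewrite /=; ring_pairing.
Qed.

(** Moving the row on the right contributes [- c] times the pairing of [r K^k] with [r K].
    [pairing_shift] evaluates its difference from the pairing of [r K^(k+1)] with [r]; the product
    [a_k a_0] cancels and the terms in [w1], [w2], [w3] remain. *)
Lemma pairing_self_x k :
  is_cderive (fun y => pair (r y) (iter k shift (r y)) (r y)) s
    (- c * (pair (r s) (iter k shift (r s)) w1 * (pair (r s) (r s) w1)^*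
          + pair (r s) (iter k shift (r s)) w2 * (pair (r s) (r s) w2)^*
          + pair (r s) (iter k shift (r s)) w3 * (pair (r s) (r s) w3)^*)).
Proof.
have := is_cderive_pairing dressing_x (is_mxderive_iter_shift k dr) dr.
move=> d; apply: is_cderive_eq d _.
rewrite sandwichZ sandwich_rank1 iter_shift_rowZ pairingZl -iterSr.
rewrite pairingZr c_conj iterS pairing_shift // !pairing_conj //.
rewrite /=; ring_pairing.
Qed.

End SpaceFlow.

Section TimeFlow.
Variables (r : R -> 'rV[R[i]]_n) (s : R) (c d : R[i]).
Hypotheses (c_conj : c^* = - c) (d_conj : d^* = - d).
Hypothesis dr :
  is_mxderive r s (c *: iter 3 shift (r s) + d *: iter 2 shift (r s)).

(** The differences of cubes and of squares of [l_j] and [conj l_k] both contain [l_j - conj l_k];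
    the cofactors give three and two rank-one terms. *)
Lemma dressing_t : is_mxderive (fun y => dressing (r y)) s
  (c *: (adjmx (r s) *m iter 2 shift (r s) + adjmx (shift (r s)) *m shift (r s)
         + adjmx (iter 2 shift (r s)) *m r s)
   + d *: (adjmx (r s) *m shift (r s) + adjmx (shift (r s)) *m r s)).
Proof.
apply: is_mxderive_dressing dr _ => k j.
have rE h : (c *: iter 3 shift (r s) + d *: iter 2 shift (r s)) 0 h =
    (c * l 0 h ^+ 3 + d * l 0 h ^+ 2) * r s 0 h.
  rewrite mxE [X in X + _]mxE [X in _ + X]mxE /= !shift_rowE.
  by move: (r s 0 h) (l 0 h) => rh lh; ring.
rewrite !rE [X in _ = X * _]mxE [X in _ = (X + _) * _]mxE.
rewrite [X in _ = (_ + X) * _]mxE [X in _ = (_ * X + _) * _]mxE.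
rewrite [X in _ = (_ * (X + _) + _) * _]mxE [X in _ = (_ + _ * X) * _]mxE.
rewrite !adjmx_mulE /= !shift_rowE !(rmorphM, rmorphD, rmorphXn) /=.
rewrite c_conj d_conj.
move: (r s 0 k) (r s 0 j) (l 0 k) (l 0 j) => rk rj lk lj.
move: (rk^*) (lk^*) => rk' lk'.
by ring.
Qed.

(** Each rank-one term of [M_t] yields a product of a pairing of [r] with [r K^m] and a pairing with
    [q]; [rho1] and [rho2] are the former for [m = 1, 2]. *)
Lemma pairing_t q :
  let a k := pair (r s) (iter k shift (r s)) (r s) in
  let b w k := pair (r s) (iter k shift (r s)) w in
  let s0 := b w1 0 * (b w1 0)^* + b w2 0 * (b w2 0)^* + b w3 0 * (b w3 0)^* in
  let s1 := b w1 1 * (b w1 0)^* + b w2 1 * (b w2 0)^* + b w3 1 * (b w3 0)^* in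
  let s01 := b w1 0 * (b w1 1)^* + b w2 0 * (b w2 1)^* + b w3 0 * (b w3 1)^* in
  let rho1 := a 1 - a 0 ^+ 2 + s0 in
  let rho2 := a 2 - a 1 * a 0 + s1 - a 0 * rho1 + s01 in
  is_cderive (fun y => pair (r y) (r y) q) s
    (c * (b q 3 - a 0 * b q 2 - rho1 * b q 1 - rho2 * b q 0)
     + d * (b q 2 - a 0 * b q 1 - rho1 * b q 0)).
Proof.
move=> a b s0 s1 s01 rho1 rho2.
have shiftE := @pairing_shift _ _ l w1 w2 w3 l_inj l_gt0 w3_neq0 (r s).
have rho1E : pair (r s) (r s) (shift (r s)) = rho1.
  have := shiftE (r s) (r s).
  rewrite /rho1 /s0 /a /b /= => ->; rewrite !pairing_conj //.
  rewrite /=; ring_pairing.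
(* Two shifts, passing through the pairing of [r K] with itself. *)
have rho2E : pair (r s) (r s) (shift (shift (r s))) = rho2.
  have := shiftE (r s) (shift (r s)).
  have := shiftE (shift (r s)) (r s).
  rewrite /rho2 /s1 /s01 -rho1E /a /b /= => -> ->; rewrite !pairing_conj //.
  rewrite /=; ring_pairing.
have := is_cderive_pairing dressing_t dr (is_mxderive_cst q s).
move=> dP; apply: is_cderive_eq dP _.
rewrite /a /b /=; set r1 := shift (r s) in rho1E rho2E *.
set r2 := shift r1 in rho2E *; set r3 := shift r2.
(* The shifted rows become opaque, so that the rewriting cannot unfold them. *)
clearbody r3; clearbody r2; clearbody r1.
rewrite sandwichD 2!sandwichZ 3!sandwichD 5!sandwich_rank1.
rewrite pairingDl 2!pairingZl rho1E rho2E.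
have -> : pair (r s) (r s) 0 = 0.
  by rewrite -(scale0r (0 : 'rV_n)) pairingZr rmorph0 mul0r.
ring_pairing.
Qed.

End TimeFlow.
End SolitonFlow.

(** * The N-soliton solution *)

Section SolitonPairing.
Variables (R : realType) (eps : R) (N : nat).
Variables (lambda alpha beta gamma : 'I_N -> R[i]).

Let kappa : R[i] := - 3 * 'i%C * (c1 eps)%:C.

Definition soliton_row x t : 'rV[R[i]]_N :=
  \row_j (alpha j * cexp (- 3 * theta eps (lambda j) x t)).

Local Notation row_of w := (\row_j w j).
Local Notation l := (row_of lambda).
Local Notation r := soliton_row.
Local Notation w1 := (row_of beta).
Local Notation w2 := (row_of gamma).
Local Notation w3 := (\row_(j < N) (1 : R[i])).
Local Notation dressing x t := (dressing_mx l w1 w2 w3 (r x t)).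
Local Notation pair x t := (pairing l w1 w2 w3 (r x t)).

Local Notation e x t j := (cexp (theta eps (lambda j) x t)).
Local Notation e3 x t j := (cexp (- 3 * theta eps (lambda j) x t)).

Lemma cexp_theta_scale x t j :
  cexp (- 2 * theta eps (lambda j) x t) = e x t j * e3 x t j.
Proof.
rewrite -cexpD; congr cexp.
by move: (theta _ _ _ _) => th; ring.
Qed.

(** Since [e^(-2 theta) = e^theta e^(-3 theta)], every numerator has the factor [conj e_k * e_j]:
    the two matrices are congruent by a diagonal matrix. *)
Lemma soliton_mxE x t : soliton_mx eps lambda alpha beta gamma x t =
  diag_mx (\row_j (e x t j)^*) *m dressing x t *m diag_mx (\row_j e x t j).
Proof.
apply/matrixP => k j; rewrite mul_mx_diag mxE [in RHS]mul_diag_mx !mxE.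
rewrite mulrDr !cexpD.
have -> : cexp (- 2 * (theta eps (lambda k) x t)^*) = (e x t k * e3 x t k)^*.
  rewrite -cexp_theta_scale conj_cexp; move: (theta _ _ _ _) => th.
  by rewrite rmorphM rmorphN rmorph_nat.
rewrite cexp_theta_scale -conj_cexp !rmorphM conjC1 /=.
move: (e x t k) (e x t j) (e3 x t k) (e3 x t j) (_^-1) => ek ej ck cj d.
move: (ek^*) (ck^*) (alpha k)^* (beta k)^* (gamma k)^* => ek' ck' ak bk gk.
by ring.
Qed.

Hypothesis lambda_inj : injective lambda.
Hypothesis eta_gt0 : forall j, 0 < complex.Im (lambda j).

Lemma row_lambda_inj : injective (l 0).
Proof. by move=> i j; rewrite !mxE => /lambda_inj. Qed.

Lemma row_lambda_im j : 0 < 'Im (l 0 j).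
Proof. by rewrite mxE -complexIm ltcR. Qed.

Lemma row_one_neq0 j : w3 0 j != 0.
Proof. by rewrite mxE oner_neq0. Qed.

Lemma dressing_unit x t : dressing x t \in unitmx.
Proof.
apply: dressing_mx_unit.
- exact: row_lambda_inj.
- exact: row_lambda_im.
- exact: row_one_neq0.
Qed.

Lemma diag_mx_unit (d : 'rV[R[i]]_N) : (forall j, d 0 j != 0) ->
  diag_mx d \in unitmx.
Proof. by move=> d0; rewrite unitmxE det_diag unitfE; apply/prodf_neq0. Qed.

Lemma soliton_mx_unit x t :
  soliton_mx eps lambda alpha beta gamma x t \in unitmx.
Proof.
rewrite soliton_mxE !unitmx_mul dressing_unit andbT.
by rewrite !diag_mx_unit // => j; rewrite mxE ?conjC_eq0 cexp_neq0.
Qed.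

Lemma invmx_soliton_mx x t k j :
  invmx (soliton_mx eps lambda alpha beta gamma x t) k j =
  (e x t k)^-1 * invmx (dressing x t) k j * ((e x t j)^*)^-1.
Proof.
pose X := diag_mx (\row_j (e x t j)^-1) *m invmx (dressing x t)
  *m diag_mx (\row_j ((e x t j)^*)^-1).
have diagV (d d' : 'rV[R[i]]_N) : (forall h, d 0 h * d' 0 h = 1) ->
    diag_mx d *m diag_mx d' = 1%:M.
  move=> dd'; apply/matrixP => p q; rewrite mul_diag_mx !mxE.
  by rewrite mulrnAr dd'.
have SX : soliton_mx eps lambda alpha beta gamma x t *m X = 1%:M.
  rewrite soliton_mxE /X !mulmxA -(mulmxA _ (diag_mx _) (diag_mx _)) diagV.
    rewrite mulmx1 mulmxK ?dressing_unit // diagV // => h.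
    by rewrite !mxE divff // conjC_eq0 cexp_neq0.
  by move=> h; rewrite !mxE divff // cexp_neq0.
have -> : invmx (soliton_mx eps lambda alpha beta gamma x t) = X.
  by rewrite -[LHS]mulmx1 -SX mulKmx // soliton_mx_unit.
by rewrite /X mul_mx_diag mxE mul_diag_mx !mxE.
Qed.

(** The diagonal factors of the inverse turn [e^(-2 theta_k)] into [e^(-3 theta_k)] and cancel
    [e^(conj theta_j)]; the prefactor [3 i c_1] is [- kappa]. *)
Lemma solitonE w x t : soliton eps lambda alpha beta gamma w x t =
  - kappa * pair x t (r x t) (row_of w).
Proof.
rewrite /soliton /kappa /pairing !mulNr opprK; congr (_ * _).
rewrite mxE exchange_big /=; apply: eq_bigr => j _.
rewrite mxE mulr_suml; apply: eq_bigr => k _.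
rewrite invmx_soliton_mx cexpD cexp_theta_scale -conj_cexp !mxE.
have e0 : e x t k != 0 by exact: cexp_neq0.
have e0' : (e x t j)^* != 0 by rewrite conjC_eq0 cexp_neq0.
move: (e x t k) (e x t j)^* (e3 x t k) (invmx _ _ _) e0 e0'.
move=> ek ej ck D e0 e0'.
by field; rewrite e0 e0'.
Qed.

Lemma soliton_row_x x t :
  is_mxderive (fun y => r y t) x (kappa *: shift_row l (r x t)).
Proof.
move=> i j; rewrite ord1 mxE shift_rowE !mxE.
(* The part of the exponent that is constant in [x]. *)
set m := - 3 * 'i%C * ((c2 eps)%:C * lambda j ^+ 3 * t%:C
  + (c3 eps)%:C * lambda j ^+ 2 * t%:C).
have thE y : - 3 * theta eps (lambda j) y t = kappa * lambda j * y%:C + m.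
  by rewrite /theta /m /kappa; ring.
apply: is_cderive_eq (is_cderive_ext _
  (is_cderiveZ (alpha j) (is_cderive_cexp (kappa * lambda j) m x))) _.
  by move=> y; rewrite mxE thE.
rewrite thE; move: (cexp _) => E.
by ring.
Qed.

Let kappa2 : R[i] := - 3 * 'i%C * (c2 eps)%:C.
Let kappa3 : R[i] := - 3 * 'i%C * (c3 eps)%:C.

Lemma soliton_row_t x t :
  is_mxderive (fun s => r x s) t (kappa2 *: iter 3 (shift_row l) (r x t)
    + kappa3 *: iter 2 (shift_row l) (r x t)).
Proof.
move=> i j; rewrite ord1 mxE [X in X + _]mxE [X in _ + X]mxE /=.
rewrite !shift_rowE !mxE.
set k := kappa2 * lambda j ^+ 3 + kappa3 * lambda j ^+ 2.
have thE s : - 3 * theta eps (lambda j) x s =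
    k * s%:C + kappa * lambda j * x%:C.
  by rewrite /theta /k /kappa /kappa2 /kappa3; ring.
apply: is_cderive_eq (is_cderive_ext _
  (is_cderiveZ (alpha j) (is_cderive_cexp k (kappa * lambda j * x%:C) t))) _.
  by move=> y; rewrite mxE thE.
rewrite thE /k; move: (cexp _) => E.
by ring.
Qed.

Let a n x t := pair x t (iter n (shift_row l) (r x t)) (r x t).
Let b w n x t := pair x t (iter n (shift_row l) (r x t)) (row_of w).

Lemma soliton_flow_x w n x t : is_cderive (fun y => b w n y t) x
  (kappa * (b w n.+1 x t - a n x t * b w 0 x t)).
Proof.
apply: (@pairing_x _ _ l w1 w2 w3 row_lambda_inj row_lambda_im row_one_neq0
  (fun y => r y t)).
  exact: kappa_conj.
exact: soliton_row_x.
Qed.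

Lemma soliton_flow_self_x n x t : is_cderive (fun y => a n y t) x
  (- kappa * (b beta n x t * (b beta 0 x t)^*
            + b gamma n x t * (b gamma 0 x t)^*
            + b (fun=> 1) n x t * (b (fun=> 1) 0 x t)^*)).
Proof.
apply: (@pairing_self_x _ _ l w1 w2 w3 row_lambda_inj row_lambda_im row_one_neq0
  (fun y => r y t)).
  exact: kappa_conj.
exact: soliton_row_x.
Qed.

Lemma soliton_self_conj x t : (a 0 x t)^* = - a 0 x t.
Proof.
exact: (@pairing_conj _ _ l w1 w2 w3 row_lambda_inj row_lambda_im row_one_neq0).
Qed.

Let S n m x t := b beta n x t * (b beta m x t)^*
  + b gamma n x t * (b gamma m x t)^*
  + b (fun=> 1) n x t * (b (fun=> 1) m x t)^*.

Lemma soliton_flow_t w : flow_t eps a S (b w).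
Proof.
move=> x t.
exact: (@pairing_t _ _ l w1 w2 w3 row_lambda_inj row_lambda_im row_one_neq0
  (fun s => r x s) t kappa2 kappa3 (conj_im_scalar _) (conj_im_scalar _)
  (soliton_row_t x t) (row_of w)).
Qed.

Hypothesis eps_neq0 : eps != 0.

Lemma soliton_hirota : hirota_solution eps
  (soliton eps lambda alpha beta gamma beta)
  (soliton eps lambda alpha beta gamma gamma)
  (soliton eps lambda alpha beta gamma (fun=> 1)).
Proof.
have solE w : soliton eps lambda alpha beta gamma w =
    fun x t => - kappa * b w 0 x t.
  by apply/funext => x; apply/funext => t; exact: solitonE.
rewrite !solE; apply: (@flow_hirota _ eps eps_neq0 a _ _ _ S) => //.
- exact: soliton_self_conj.
- exact: soliton_flow_self_x.
- exact: soliton_flow_x.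
- exact: soliton_flow_x.
- exact: soliton_flow_x.
- exact: soliton_flow_t.
- exact: soliton_flow_t.
- exact: soliton_flow_t.
Qed.

End SolitonPairing.

Theorem mainTheorem1 (R : realType) (eps : R) (N : nat)
    (lambda alpha beta gamma : 'I_N -> R[i])
    (eps_neq0 : eps != 0)
    (N_ge1 : (1 <= N)%N)
    (lambda_inj : injective lambda)
    (xi_neq0 : forall j : 'I_N, complex.Re (lambda j) != 0)
    (eta_gt0 : forall j : 'I_N, 0 < complex.Im (lambda j)) :
  (forall x t : R,
     soliton_mx eps lambda alpha beta gamma x t \in unitmx) /\
  hirota_solution eps
    (soliton eps lambda alpha beta gamma beta)
    (soliton eps lambda alpha beta gamma gamma)
    (soliton eps lambda alpha beta gamma (fun=> 1)).
Proof.
split=> [x t|]; first exact: soliton_mx_unit.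
exact: soliton_hirota.
Qed.
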